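(* Let $X$ be locally compact Hausdorff. If $(\mu_\alpha)$ satisfies a large deviation principle with powers $(t_\alpha)$, then the rate function $J$ is given by $$J(x)=\sup_{h\in\mathcal{A}}\{h(x)-\Lambda(h)\}\quad\text{for all }x\in X,$$ where $\mathcal{A}$ is any algebra of real-valued continuous functions on $X$ vanishing at $\infty$, which separates the points and does not vanish identically at any point of $X$.
   Context: $X$ is not reduced to one point. $(\mu_\alpha)$ is a net of Borel probability measures on $X$ and $(t_\alpha)$ a net (same index set) in $]0,+\infty[$ converging to $0$. Write $\mu_\alpha^{t_\alpha}(A)=(\mu_\alpha(A))^{t_\alpha}$ for Borel $A$, and $\mu_\alpha^{t_\alpha}(e^{h/t_\alpha})=\big(\int_X e^{h(x)/t_\alpha}\mu_\alpha(dx)\big)^{t_\alpha}$ for Borel measurable $h$. $\Lambda(h)=\log\lim\mu_\alpha^{t_\alpha}(e^{h/t_\alpha})$ when this limit exists (in $[-\infty,+\infty]$ for $\Lambda(h)$); existence of $\Lambda(h)$ for $h\in\mathcal{A}$ is part of the assertion. Large deviation principle with powers $(t_\alpha)$: for a function $l:X\to[0,+\infty]$, $\limsup\mu_\alpha^{t_\alpha}(F)\le\sup_{x\in F}e^{-l(x)}$ for all closed $F$ and $\sup_{x\in G}e^{-l(x)}\le\liminf\mu_\alpha^{t_\alpha}(G)$ for all open $G$; the lower regularization of $l$ (the greatest lower semi-continuous function $\le l$) is then called a rate function (it is unique when $X$ is regular). Algebras are real algebras under pointwise operations, not necessarily unital. A continuous function $h$ vanishes at $\infty$ if $\{x:|h(x)|\ge\varepsilon\}$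 is compact for every $\varepsilon>0$. $\mathcal{A}$ separates the points if for all $x\ne y$ there is $h\in\mathcal{A}$ with $h(x)\ne h(y)$; it does not vanish identically at any point if for every $x$ there is $h\in\mathcal{A}$ with $h(x)\neq0$. *)

(* Defs.v *)
(* MathComp-Analysis *)
From HB Require Import structures.
From mathcomp Require Import all_boot all_order all_algebra.
From mathcomp Require Import all_classical all_reals all_analysis.

Set Implicit Arguments.
Unset Strict Implicit.
Unset Printing Implicit Defensive.

Import Order.TTheory GRing.Theory Num.Theory.
Import numFieldNormedType.Exports.

Local Open Scope classical_set_scope.
Local Open Scope ring_scope.
Local Open Scope ereal_scope.

(* [le a b] reads "b is further along than a". *)
Record directed (I : Type) (le : I -> I -> Prop) : Prop := Directed {
  directed_inhabited : exists a : I, True ;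
  directed_refl : forall a, le a a ;
  directed_trans : forall a b c, le a b -> le b c -> le a c ;
  directed_ub : forall a b, exists c, le a c /\ le b c }.

Definition net_filter (I : Type) (le : I -> I -> Prop) : set_system I :=
  filter_from [set: I] (fun a => [set b | le a b]).

(* [limf_esup] and [limf_einf] require a [filteredType] as index type, hence
   these versions for nets. *)
Definition net_limsup (R : realType) (I : Type) (le : I -> I -> Prop)
    (u : I -> \bar R) : \bar R :=
  ereal_inf [set ereal_sup [set u b | b in le a] | a in [set: I]].

Definition net_liminf (R : realType) (I : Type) (le : I -> I -> Prop)
    (u : I -> \bar R) : \bar R :=
  ereal_sup [set ereal_inf [set u b | b in le a] | a in [set: I]].

(* [X] is pointed because the library's generated sigma-algebras require it; a
   space carrying a probability measure is nonempty anyway. *)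
Notation borel X := (g_sigma_algebraType (@open X)).

Section large_deviations.
Context (R : realType) (X : ptopologicalType) (I : Type).
Context (le : I -> I -> Prop).
Context (mu : I -> probability (borel X) R) (t : I -> R).

Definition measure_pow (A : set X) (a : I) : \bar R :=
  (mu a A) `^ (t a).

Definition exp_integral_pow (h : X -> R) (a : I) : \bar R :=
  (\int[mu a]_x (expR (h x / t a))%:E) `^ (t a).

Definition has_Lambda (h : X -> R) : Prop :=
  cvg (exp_integral_pow h @ net_filter le).

(* Meaningful under [has_Lambda h]; [lne 0 = -oo] and [lne +oo = +oo]. *)
Definition Lambda (h : X -> R) : \bar R :=
  lne (lim (exp_integral_pow h @ net_filter le)).

(* The supremum is taken in [0, +oo], so it is 0 over the empty set, whereas
   [ereal_sup set0 = -oo]. *)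
Definition sup_exp (l : X -> \bar R) (A : set X) : \bar R :=
  maxe 0 (ereal_sup [set expeR (- l x) | x in A]).

Record large_deviation_principle (l : X -> \bar R) : Prop :=
  LargeDeviationPrinciple {
  ldp_ge0 : forall x, 0 <= l x ;
  ldp_closed : forall F : set X, closed F ->
    net_limsup le (measure_pow F) <= sup_exp l F ;
  ldp_open : forall G : set X, open G ->
    sup_exp l G <= net_liminf le (measure_pow G) }.

Definition is_lower_regularization (l J : X -> \bar R) : Prop :=
  [/\ lower_semicontinuous J, forall x, J x <= l x &
      forall g : X -> \bar R, lower_semicontinuous g ->
        (forall x, g x <= l x) -> forall x, g x <= J x].

Definition is_rate_function (J : X -> \bar R) : Prop :=
  exists2 l : X -> \bar R,
    large_deviation_principle l & is_lower_regularization l J.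

End large_deviations.

Lemma lower_regularization_exists (R : realType) (X : ptopologicalType)
    (l : X -> \bar R) : exists J, is_lower_regularization l J.
Proof.
pose S := [set g : X -> \bar R | lower_semicontinuous g /\ forall x, g x <= l x].
exists (fun x => ereal_sup [set g x | g in S]); split.
- move=> x a /ereal_sup_gt[_ [g [lg gl] <-] ag].
  have [V Vx aV] := lg x a ag; exists V => // y Vy.
  by apply: (lt_le_trans (aV y Vy)); apply: ereal_sup_ubound; exists g.
- by move=> x; apply: ge_ereal_sup => _ [g [_ gl] <-].
- by move=> g lg gl x; apply: ereal_sup_ubound; exists g.
Qed.

Section function_algebras.
Context (R : realType) (X : ptopologicalType).

Definition vanishes_at_infinity (h : X -> R) : Prop :=
  forall e : R, (0 < e)%R -> compact [set x | (e <= `|h x|)%R].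

(* Not required to contain the constant functions. *)
Record function_algebra (A : set (X -> R)) : Prop := FunctionAlgebra {
  algebra0 : A (fun=> 0%R) ;
  algebraD : forall f g, A f -> A g -> A (fun x => f x + g x)%R ;
  algebraZ : forall (c : R) f, A f -> A (fun x => c * f x)%R ;
  algebraM : forall f g, A f -> A g -> A (fun x => f x * g x)%R }.

Definition separates_points (A : set (X -> R)) : Prop :=
  forall x y : X, x <> y -> exists2 h, A h & h x <> h y.

Definition vanishes_nowhere_identically (A : set (X -> R)) : Prop :=
  forall x : X, exists2 h, A h & h x <> 0%R.

End function_algebras.

(* Main.v *)
Require Import Defs.
From HB Require Import structures.
From mathcomp Require Import all_boot all_order all_algebra.
From mathcomp Require Import all_classical all_reals all_analysis.
From mathcomp Require Import measurable_realfun ring lra.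

(* Varadhan's argument applied to a bounded continuous [h] (slice the range of
   [h] for the upper bound, use the open sets [h > h x - e] for the lower one)
   shows that [Lambda h] exists and is the supremum of [h - l]. Each
   [h - Lambda h] is then lower semicontinuous and at most [l], hence at most
   [J]. Conversely, if [a < J x] with [a > 0], then [a < J] on some neighborhood
   [V] of [x], and it suffices to find [h] in the algebra with [h <= h x = a]
   everywhere and [h <= e] off [V]. No Stone-Weierstrass theorem is needed: take
   [h = a * e0 * (1 - v / M)^n], where [e0 <= 1 = e0 x], and where [0 <= v <= M]
   vanishes at [x] and is positive on the compact part of the complement of [V]
   where [e0] is not small. *)

Set Implicit Arguments.
Unset Strict Implicit.
Unset Printing Implicit Defensive.

Import Order.TTheory GRing.Theory Num.Theory.
Import numFieldNormedType.Exports.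

Local Open Scope classical_set_scope.
Local Open Scope ring_scope.
Local Open Scope ereal_scope.

(** * Peak functions in algebras of functions vanishing at infinity *)

Lemma vanishes_at_infinity_bounded (R : realType) (X : ptopologicalType)
    (h : X -> R) : continuous h -> vanishes_at_infinity h ->
  exists M : R, forall x, (`|h x| <= M)%R.
Proof.
move=> ch /(_ 1%R ltr01) cpt.
have /compact_bounded[M [_ hM]] : compact (h @` [set x | (1 <= `|h x|)%R]).
  by apply: continuous_compact cpt => //; exact: continuous_subspaceT.
(* [compact_bounded] only supplies bounds strictly above [M], hence [M + 1]; off the compact set the
   bound 1 serves. *)
exists (Num.max (M + 1) 1)%R => x; rewrite le_max.
have [h1|/ltW ->] := leP 1%R `|h x|%R; last by rewrite orbT.
by rewrite (hM (M + 1)%R) ?ltrDl//; exists x.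
Qed.

Section peak.
Context (R : realType) (X : ptopologicalType) (A : set (X -> R)).
Hypothesis A_algebra : function_algebra A.
Hypothesis A_continuous : forall h, A h -> continuous h.
Hypothesis A_vanishes : forall h, A h -> vanishes_at_infinity h.
Hypothesis A_separates : separates_points A.
Hypothesis A_nonzero : vanishes_nowhere_identically A.

Lemma algebraB f g : A f -> A g -> A (fun x => f x - g x)%R.
Proof.
move=> Af Ag; rewrite (_ : (fun x => _) = (fun x => f x + -1 * g x)%R).
  by apply: (algebraD A_algebra) => //; exact: (algebraZ A_algebra).
by apply/funext => x; rewrite mulN1r.
Qed.

Lemma algebra_sum (T : Type) (s : seq T) (f : T -> X -> R) :
  (forall i, A (f i)) -> A (fun x => \sum_(i <- s) f i x)%R.
Proof.
move=> Af; elim: s => [|i s ih].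
  rewrite (_ : (fun x => _) = (fun=> 0%R)); first exact: (algebra0 A_algebra).
  by apply/funext => x; rewrite big_nil.
rewrite (_ : (fun x => _) = (fun x => f i x + \sum_(j <- s) f j x)%R).
  exact: (algebraD A_algebra).
by apply/funext => x; rewrite big_cons.
Qed.

(** The algebra need not be unital, so [(1 - v / M) ^+ n] alone may lie outside it; the factor [e]
    keeps every partial product inside. *)
Lemma algebra_mul_pow (n : nat) (e v : X -> R) (M : R) : A e -> A v ->
  A (fun x => e x * (1 - v x / M) ^+ n)%R.
Proof.
move=> Ae Av; elim: n => [|n ih].
  by rewrite (_ : (fun x => _) = e)//; apply/funext => x; rewrite expr0 mulr1.
rewrite (_ : (fun x => _) = (fun x => e x * (1 - v x / M) ^+ n -
    M^-1 * ((e x * (1 - v x / M) ^+ n) * v x))%R).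
  apply: algebraB => //; apply: (algebraZ A_algebra); exact: (algebraM A_algebra).
by apply/funext => x; rewrite exprSr; ring.
Qed.

(** If [f] separates [x] from [y] and [q] is nonzero at [y], the square of [q * (f - f x)] works;
    [q] stands in for constants, which the algebra may lack. *)
Lemma algebra_vanishing_at (x y : X) : x <> y ->
  exists v, [/\ A v, v x = 0%R, forall z, (0 <= v z)%R & (0 < v y)%R].
Proof.
move=> xy; have [f Af fxy] := A_separates xy; have [q Aq qy] := A_nonzero y.
pose w z := (q z * f z - f x * q z)%R.
have Aw : A w.
  by apply: algebraB; [exact: (algebraM A_algebra)|exact: (algebraZ A_algebra)].
exists (fun z => w z * w z)%R; split.
- exact: (algebraM A_algebra).
- by rewrite /w; ring.
- by move=> z; rewrite -expr2 sqr_ge0.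
- rewrite -expr2 exprn_even_gt0//= /w [X in (X - _)%R]mulrC -mulrBl mulf_neq0//; last exact/eqP.
  by rewrite subr_eq0; apply/eqP => /esym.
Qed.

(** Finitely many of the open sets where some [w y] is positive cover [K], and a sum of nonnegative
    functions is positive wherever one of them is. *)
Lemma algebra_positive_on_compact (x : X) (K : set X) : compact K -> ~ K x ->
  exists v, [/\ A v, v x = 0%R, forall z, (0 <= v z)%R &
    forall y, K y -> (0 < v y)%R].
Proof.
move=> cK Kx.
have /choice[w Hw] : forall y, exists v, [/\ A v, v x = 0%R,
    forall z, (0 <= v z)%R & K y -> (0 < v y)%R].
  move=> y; have [Ky|nKy] := pselect (K y).
    have [|v [Av vx v0 vy]] := @algebra_vanishing_at x y; last by exists v.
    by move=> xy; apply: Kx; rewrite xy.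
  by exists (fun=> 0%R); split => //; exact: (algebra0 A_algebra).
move: cK; rewrite compact_cover => /(_ X K (fun y => [set z | 0 < w y z]%R))[].
- move=> y _; apply: (@open_comp _ _ (w y) [set r | 0 < r]%R) => [z _|].
    by apply: A_continuous; case: (Hw y).
  exact: open_gt.
- by move=> y Ky; exists y => //; case: (Hw y) => _ _ _; exact.
move=> D _ KD; exists (fun z => \sum_(y <- finmap.enum_fset D) w y z)%R; split.
- by apply: algebra_sum => y; case: (Hw y).
- by apply: big1 => y _; case: (Hw y).
- by move=> z; apply: sumr_ge0 => y _; case: (Hw y).
- move=> z /KD[y /= yD wyz]; rewrite (big_rem y)//= ltr_pwDl//.
  by apply: sumr_ge0 => i _; case: (Hw i).
Qed.

Lemma algebra_peak (x : X) (V : set X) (eps : R) : nbhs x V -> (0 < eps)%R ->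
  exists2 h, A h & [/\ h x = 1%R, forall y, (h y <= 1)%R &
    forall y, ~ V y -> (h y <= eps)%R].
Proof.
move=> Vx eps0.
have [s0 As0 s0x] := A_nonzero x.
pose s y := ((s0 x)^-1 * s0 y)%R.
have As : A s by exact: (algebraZ A_algebra).
have sx : s x = 1%R by rewrite /s mulVf//; exact/eqP.
(* [2 s - s^2 = 1 - (1 - s)^2] is at most 1 everywhere and equals 1 at [x]. *)
pose e y := (2 * s y - s y * s y)%R.
have Ae : A e.
  by apply: algebraB; [exact: (algebraZ A_algebra)|exact: (algebraM A_algebra)].
have ex : e x = 1%R by rewrite /e sx; ring.
have e1 y : (e y <= 1)%R.
  by rewrite -subr_ge0 (_ : 1 - e y = (1 - s y) ^+ 2)%R ?sqr_ge0// /e; ring.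
(* Off [V], only the points where [e] is at least [eps] need damping. Removing the interior rather
   than [V] itself keeps [K] closed. *)
pose K := [set y | eps <= e y]%R `\` V°.
have cK : compact K.
  apply: (@subclosed_compact _ _ [set y | eps <= `|e y|]%R).
  - apply: closedI; last exact/open_closedC/open_interior.
    apply: (@preimage_closed _ _ e [set r | eps <= r]%R) => [y _|].
      exact: A_continuous.
    exact: closed_ge.
  - exact: A_vanishes.
  - by move=> y [/= ey _]; rewrite (le_trans ey)// ler_norm.
have [v [Av vx v0 vK]] : exists v, [/\ A v, v x = 0%R, forall z, (0 <= v z)%R &
    forall y, K y -> (0 < v y)%R].
  by apply: algebra_positive_on_compact cK _ => -[_]; apply.
have [M0 vM0] := vanishes_at_infinity_bounded (A_continuous Av) (A_vanishes Av).
pose M := (Num.max M0 1)%R.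
have M_gt0 : (0 < M)%R by rewrite lt_max ltr01 orbT.
have vM y : (v y / M <= 1)%R.
  rewrite ler_pdivrMr// mul1r (le_trans (ler_norm _))// (le_trans (vM0 _))//.
  by rewrite le_max lexx.
have q_ge0 y : (0 <= 1 - v y / M)%R by rewrite subr_ge0.
have q_le1 y : (1 - v y / M <= 1)%R.
  by rewrite gerBl divr_ge0// ltW.
(* On a nonempty [K], [v] attains a positive minimum, so the powers of [1 - v / M] tend to 0
   uniformly there. *)
have [n Hn] : exists n : nat, forall y, K y -> ((1 - v y / M) ^+ n <= eps)%R.
  have [K0|/set0P K0] := eqVneq K set0.
    by exists 0%N => y; rewrite K0.
  have [|c cKc cmin] := compact_EVT_min (f := v) K0 cK.
    by apply: continuous_subspaceT; exact: A_continuous.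
  have vc : (0 < v c)%R by apply: vK; rewrite inE in cKc.
  have /cvg_expr/cvgr_lt/(_ _ eps0)[n _ /(_ n (leqnn n))/= qn] :
      (`|1 - v c / M| < 1)%R.
    by rewrite ger0_norm// gtrBl divr_gt0.
  exists n => y Ky; apply: le_trans (ltW qn).
  apply: lerXn2r; rewrite ?nnegrE// lerB// ler_wpM2r// ?invr_ge0 ?(ltW M_gt0)//.
  by apply: cmin; rewrite inE.
exists (fun y => e y * (1 - v y / M) ^+ n)%R; first exact: algebra_mul_pow.
have qn_ge0 y : (0 <= (1 - v y / M) ^+ n)%R by rewrite exprn_ge0.
have qn_le1 y : ((1 - v y / M) ^+ n <= 1)%R by rewrite exprn_ile1.
split.
- by rewrite vx mul0r subr0 expr1n ex mulr1.
- by move=> y; rewrite (le_trans _ (qn_le1 y))// ler_piMl.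
(* Either [y] is in [K] and the power is small, or [e y < eps] and a factor between 0 and 1 cannot
   push the product above [eps]. *)
- move=> y Vy; have [ey|ey] := leP eps (e y).
    rewrite (le_trans _ (Hn y _))//; first by rewrite ler_piMl.
    by split => // /interior_subset.
  have [e0|e0] := leP 0%R (e y).
    by rewrite (le_trans _ (ltW ey))// ler_piMr.
  by rewrite (le_trans _ (ltW eps0))// mulr_le0_ge0// ltW.
Qed.

End peak.

(** * Upper and lower limits along a directed set *)

Section nets.
Context (R : realType) (I : Type) (le : I -> I -> Prop).
Hypothesis le_directed : directed le.

Lemma net_filter_proper : ProperFilter (net_filter le).
Proof.
have [[a _] lerefl letrans leub] := le_directed.
apply: filter_from_proper; last by move=> b _; exists b; exact: lerefl.
apply: filter_from_filter; first by exists a.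
move=> b c _ _; have [d [bd cd]] := leub b c; exists d => // e de.
by split; exact: letrans de.
Qed.
#[local] Existing Instance net_filter_proper.

Lemma net_limsup_lt (u : I -> \bar R) (b : \bar R) : net_limsup le u < b ->
  \forall a \near net_filter le, u a < b.
Proof.
move=> /ereal_inf_lt[_ [a _ <-] ub]; exists a => // c ac.
by apply: le_lt_trans ub; apply: ereal_sup_ubound; exists c.
Qed.

Lemma net_liminf_gt (u : I -> \bar R) (b : \bar R) : b < net_liminf le u ->
  \forall a \near net_filter le, b < u a.
Proof.
move=> /ereal_sup_gt[_ [a _ <-] ub]; exists a => // c ac.
by apply: lt_le_trans ub _; apply: ereal_inf_lbound; exists c.
Qed.

Lemma net_limsup_le (u : I -> \bar R) (b : \bar R) :
  (\forall a \near net_filter le, u a <= b) -> net_limsup le u <= b.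
Proof.
move=> [a _ ub]; apply: (@le_trans _ _ (ereal_sup [set u c | c in le a])).
  by apply: ereal_inf_lbound; exists a.
by apply: ge_ereal_sup => _ [c ac <-]; exact: ub.
Qed.

Lemma net_liminf_ge (u : I -> \bar R) (b : \bar R) :
  (\forall a \near net_filter le, b <= u a) -> b <= net_liminf le u.
Proof.
move=> [a _ ub]; apply: (@le_trans _ _ (ereal_inf [set u c | c in le a])).
  by apply: le_ereal_inf_tmp => _ [c ac <-]; exact: ub.
by apply: ereal_sup_ubound; exists a.
Qed.

(** By reflexivity each tail contains its first index, so no supremum is taken over the empty
    set. *)
Lemma net_limsup_ge (u : I -> \bar R) (b : \bar R) :
  (forall a, b <= u a) -> b <= net_limsup le u.
Proof.
move=> ub; apply: le_ereal_inf_tmp => _ [a _ <-].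
rewrite (le_trans (ub a))//; apply: ereal_sup_ubound; exists a => //.
exact: (directed_refl le_directed).
Qed.

(** Any two tails share an index, whose value lies between the infimum over one and the supremum
    over the other. *)
Lemma net_liminf_le_limsup (u : I -> \bar R) :
  net_liminf le u <= net_limsup le u.
Proof.
apply: ge_ereal_sup => _ [a _ <-]; apply: le_ereal_inf_tmp => _ [b _ <-].
have [c [ac bc]] := (directed_ub le_directed) a b.
apply: (@le_trans _ _ (u c)).
  by apply: ereal_inf_lbound; exists c.
by apply: ereal_sup_ubound; exists c.
Qed.

Lemma net_cvg (u : I -> \bar R) (L : R) :
  net_limsup le u <= L%:E -> L%:E <= net_liminf le u ->
  u @ net_filter le --> L%:E.
Proof.
move=> supu infu.
have uL (e : R) : (0 < e)%R -> \forall a \near net_filter le,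
    (L - e)%:E < u a < (L + e)%:E.
  move=> e0; near=> a; apply/andP; split; near: a.
    by apply: net_liminf_gt; apply: lt_le_trans infu; rewrite lte_fin gtrBl.
  by apply: net_limsup_lt; apply: le_lt_trans supu _; rewrite lte_fin ltrDl.
apply/fine_cvgP; split.
  apply: filterS (uL _ ltr01) => a.
  by case: (u a) => [r|/andP[_]|/andP[+ _]] //; rewrite ltNge ?leey ?leNye.
apply/cvgrPdist_lt => e /uL; apply: filterS => a /=.
case: (u a) => [r|/andP[_]|/andP[+ _]].
- by rewrite /= !lte_fin ltr_distlC.
- by rewrite ltNge leey.
- by rewrite ltNge leNye.
Unshelve. all: by end_near. Qed.

End nets.

(** * Powers of extended reals and Borel measurability *)

Lemma lee_poweR (R : realType) (x y : \bar R) (t : R) : 0 <= x -> 0 <= y ->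
  (0 < t)%R -> (x `^ t <= y `^ t) = (x <= y).
Proof.
move=> x0 y0 t0.
have mono (s : R) (u v : \bar R) : (0 < s)%R -> 0 <= u -> 0 <= v -> u <= v ->
    u `^ s <= v `^ s.
  by move=> s0 u0 v0; apply: gt0_ler_poweR; rewrite ?(ltW s0) ?in_itv/= ?leey ?andbT.
apply/idP/idP => [|xy]; last exact: mono.
move=> /(mono t^-1%R); rewrite -!poweRrM divff ?lt0r_neq0// !poweRe1//.
by apply; rewrite ?invr_gt0 ?poweR_ge0.
Qed.

Lemma expR_poweR (R : realType) (t c : R) : (0 < t)%R ->
  (expR (c / t))%:E `^ t = (expR c)%:E.
Proof. by move=> t0; rewrite poweR_EFin -expRM divfK ?lt0r_neq0. Qed.

(** Trades a bound on a [t]-th power for an exponential bound on the base, which can then be summed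
    and integrated. *)
Lemma poweR_le_expR (R : realType) (x : \bar R) (t c : R) : 0 <= x ->
  (0 < t)%R -> (x `^ t <= (expR c)%:E) = (x <= (expR (c / t))%:E).
Proof. by move=> x0 t0; rewrite -(expR_poweR c t0) lee_poweR// lee_fin expR_ge0. Qed.

Lemma expR_le_poweR (R : realType) (x : \bar R) (t c : R) : 0 <= x ->
  (0 < t)%R -> ((expR c)%:E <= x `^ t) = ((expR (c / t))%:E <= x).
Proof. by move=> x0 t0; rewrite -(expR_poweR c t0) lee_poweR// lee_fin expR_ge0. Qed.

Lemma continuous_borel_measurable (R : realType) (X : ptopologicalType)
    (h : X -> R) : continuous h -> measurable_fun [set: borel X] (h : borel X -> R).
Proof.
move=> ch.
apply: (@measurability _ _ (borel X) _ setT h _ (RGenOInfty.measurableE R)).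
move=> _ [_ [x ->] <-]; rewrite setTI; apply: sub_sigma_algebra.
by move/continuousP : ch; apply; exact: interval_open.
Qed.

Lemma closed_borel_measurable (X : ptopologicalType) (F : set X) :
  closed F -> measurable (F : set (borel X)).
Proof.
move=> cF; rewrite -[F]setCK; apply: measurableC; apply: sub_sigma_algebra.
exact: closed_openC.
Qed.

(** * Varadhan's lemma for bounded continuous functions *)

Section varadhan.
Context (R : realType) (X : ptopologicalType) (I : Type).
Context (le : I -> I -> Prop) (mu : I -> probability (borel X) R) (t : I -> R).
Hypothesis le_directed : directed le.
Hypothesis t_gt0 : forall a, (0 < t a)%R.
Hypothesis t_cvg0 : t @ net_filter le --> (0 : R)%R.
Context (l : X -> \bar R).
Hypothesis l_ldp : large_deviation_principle le mu t l.
Let F := net_filter le.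
#[local] Instance F_proper : ProperFilter F := net_filter_proper le_directed.

Lemma exp_integral_measurable (h : X -> R) (a : I) : continuous h ->
  measurable_fun [set: borel X] (fun x => (expR (h x / t a))%:E).
Proof.
move=> ch; apply/measurable_EFinP; apply: continuous_borel_measurable => x.
apply: (@continuous_comp _ _ _ (fun y => h y / t a)%R (@expR R)); last exact: continuous_expR.
by apply: cvgM; [exact: ch|exact: cvg_cst].
Qed.

Lemma integral_scaled_indic a (k : R) (B : set (borel X)) :
  measurable B -> (0 <= k)%R ->
  \int[mu a]_x (k * \1_B x)%:E = k%:E * mu a B.
Proof.
move=> mB k0; under eq_integral do rewrite EFinM.
rewrite ge0_integralZl_EFin//.
- by rewrite integral_indic// setIT.
- by apply/measurable_EFinP; exact: measurable_indic.
Qed.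

Lemma measurable_scaled_indic (k : R) (B : set (borel X)) : measurable B ->
  measurable_fun [set: borel X] (fun x => (k * \1_B x)%:E).
Proof.
move=> mB; apply/measurable_EFinP; exact: measurable_funM.
Qed.

(** The slack [d] puts the upper limit strictly below the bound, so the inequality holds eventually
    along the net. *)
Lemma ldp_closed_near (B : set X) (c d : R) : closed B ->
  (forall x, B x -> c%:E <= l x) -> (0 < d)%R ->
  \forall a \near F, mu a B <= (expR ((d - c) / t a))%:E.
Proof.
move=> cB Bl d0.
suff : net_limsup le (measure_pow mu t B) < (expR (d - c))%:E.
  move=> /net_limsup_lt; apply: filterS => a /ltW.
  by rewrite /measure_pow poweR_le_expR.
apply: (le_lt_trans (ldp_closed l_ldp cB)).
apply: (@le_lt_trans _ _ (expeR (- c%:E))); last first.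
  by rewrite /= lte_fin ltr_expR ltrDr.
rewrite ge_max expeR_ge0 andTb; apply: ge_ereal_sup => _ [x Bx <-].
by rewrite lee_expeR leeN2 Bl.
Qed.

Lemma ldp_open_near (G : set X) (x : X) (c d : R) : open G -> G x ->
  l x <= c%:E -> (0 < d)%R ->
  \forall a \near F, (expR ((- c - d) / t a))%:E <= mu a G.
Proof.
move=> oG Gx lx d0.
suff : (expR (- c - d))%:E < net_liminf le (measure_pow mu t G).
  move=> /net_liminf_gt; apply: filterS => a.
  by move/ltW; rewrite /measure_pow expR_le_poweR.
apply: lt_le_trans (ldp_open l_ldp oG).
apply: (@lt_le_trans _ _ (expeR (- c%:E))).
  by rewrite /= lte_fin ltr_expR gtrDl oppr_lt0.
rewrite le_max; apply/orP; right.
apply: (@le_trans _ _ (expeR (- l x))); first by rewrite lee_expeR leeN2.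
by apply: ereal_sup_ubound; exists x.
Qed.

(** The integral is at least its part over [G], where [h] exceeds [h x - e / 2], and the open-set
    bound controls the mass of [G] from below. When [l x] is [+oo] the left-hand side is 0. *)
Lemma varadhan_lower (h : X -> R) (x : X) : continuous h ->
  expeR ((h x)%:E - l x) <= net_liminf le (exp_integral_pow mu t h).
Proof.
move=> ch.
have inf_ge0 : 0 <= net_liminf le (exp_integral_pow mu t h).
  by apply: net_liminf_ge; apply: nearW => a; exact: poweR_ge0.
have := ldp_ge0 l_ldp x; case lx : (l x) => [r||]// _.
(* Writing the lower limit as an exponential makes the error [e] additive. *)
have [y yE] := expeR_total inf_ge0; rewrite -yE lee_expeR -EFinB.
apply/lee_subgt0Pr => e e0; rewrite -EFinB -lee_expeR yE /=.
pose G := [set z | h x - e / 2 < h z]%R.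
have oG : open G.
  apply: (@open_comp _ _ h [set s | h x - e / 2 < s]%R) => [z _|]; first exact: ch.
  exact: open_gt.
have e2 : (0 < e / 2)%R by rewrite divr_gt0.
have Gx : G x by rewrite /G/= gtrBl.
apply: net_liminf_ge.
apply: filterS (@ldp_open_near G x r (e / 2) oG Gx _ e2); last by rewrite lx.
move=> a muG; have t0 := t_gt0 a.
rewrite /exp_integral_pow expR_le_poweR//; last first.
  by apply: integral_ge0 => y' _; rewrite lee_fin expR_ge0.
have mG : measurable (G : set (borel X)) by exact: sub_sigma_algebra.
apply: (@le_trans _ _ (\int[mu a]_z (expR ((h x - e / 2) / t a) * \1_G z)%:E)).
  rewrite integral_scaled_indic ?expR_ge0//.
  rewrite (_ : (h x - r - e) / t a = (h x - e / 2) / t a + (- r - e / 2) / t a)%R;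
    last by rewrite -mulrDl; congr (_ / _)%R; lra.
  by rewrite expRD EFinM lee_wpmul2l// lee_fin expR_ge0.
apply: ge0_le_integral => //.
- exact: measurable_scaled_indic.
- exact: exp_integral_measurable.
- move=> z _; rewrite lee_fin indicE; have [zG|_] := boolP (z \in G).
    by rewrite mulr1 ler_expR ler_pM2r ?invr_gt0//; rewrite inE in zG; exact: ltW.
  by rewrite mulr0 expR_ge0.
Qed.

(** A step function over the closed superlevel sets [B i] dominates the integrand, and [h - s <= l]
    bounds the masses of these sets. The number [N] of steps is harmless because its [t]-th power
    tends to 1. *)
Lemma varadhan_upper (h : X -> R) (M s : R) : continuous h ->
  (forall x, `|h x| <= M)%R -> (forall x, (h x - s)%:E <= l x) ->
  net_limsup le (exp_integral_pow mu t h) <= (expR s)%:E.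
Proof.
move=> ch hM hsl.
have sup_ge0 : 0 <= net_limsup le (exp_integral_pow mu t h).
  by apply: net_limsup_ge => // a; exact: poweR_ge0.
have [y yE] := expeR_total sup_ge0; rewrite -yE -[leRHS]/(expeR s%:E) lee_expeR.
apply/lee_addgt0Pr => e e0; rewrite -EFinD -lee_expeR yE /=.
(* One [d] pays for the width of a slice, one for the slack in the closed-set bound, one for the
   factor [N]. *)
pose d := (e / 3)%R; have d0 : (0 < d)%R by rewrite divr_gt0.
(* Since [h z + M] is at most [2 * M], the slice index of [z], the truncation of [(h z + M) / d],
   stays below [N] thanks to the successor. *)
pose N := (Num.truncn (2 * M / d)%R).+1.
pose B (i : 'I_N) := [set z | - M + i%:R * d <= h z]%R.
have cB i : closed (B i).
  apply: (@preimage_closed _ _ h [set s | - M + i%:R * d <= s]%R) => [z _|].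
    exact: ch.
  exact: closed_ge.
have mB i : measurable (B i : set (borel X)) by exact: closed_borel_measurable.
have muB : \forall a \near F, forall i : 'I_N,
    mu a (B i) <= (expR ((d - (- M + i%:R * d - s)) / t a))%:E.
  apply: filter_forall => i; apply: ldp_closed_near => // x Bx.
  by apply: le_trans (hsl x); rewrite lee_fin lerB.
have tN : \forall a \near F, (t a * ln N%:R <= d)%R.
  have : (fun a => t a * ln N%:R)%R @ F --> (0 * ln N%:R : R)%R by apply: cvgM => //; exact: cvg_cst.
  by rewrite mul0r => /cvgr_le; exact.
apply: net_limsup_le; near=> a; have t0 := t_gt0 a.
have muBa : forall i : 'I_N,
  mu a (B i) <= (expR ((d - (- M + i%:R * d - s)) / t a))%:E by near: a.
have tNa : (t a * ln N%:R <= d)%R by near: a.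
rewrite /exp_integral_pow poweR_le_expR//; last first.
  by apply: integral_ge0 => z _; rewrite lee_fin expR_ge0.
pose k (i : 'I_N) := expR ((- M + i.+1%:R * d) / t a).
have k0 i : (0 <= k i)%R by exact: expR_ge0.
apply: (@le_trans _ _ (\int[mu a]_z (\sum_(i < N) (k i * \1_(B i) z)%:E))).
  apply: ge0_le_integral => //.
  - exact: exp_integral_measurable.
  - by apply: emeasurable_sum => i _; exact: measurable_scaled_indic.
  move=> z _.
  have q0 : (0 <= (h z + M) / d)%R.
    rewrite divr_ge0 ?(ltW d0)// -lerBlDr sub0r.
    by have := hM z; rewrite ler_norml => /andP[].
  have /andP[iq qi] := truncn_itv q0.
  have iN : (Num.truncn ((h z + M) / d)%R < N)%N.
    rewrite ltnS; apply: le_truncn; rewrite ler_pM2r ?invr_gt0//.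
    by have := ler_norm (h z); have := hM z; lra.
  rewrite (bigD1 (Ordinal iN))//= -[leLHS]adde0 leeD//; last first.
    by apply: sume_ge0 => i _; rewrite lee_fin mulr_ge0.
  rewrite lee_fin indicE mem_set/=; last first.
    by rewrite /B/= addrC lerBlDr -ler_pdivlMr.
  rewrite mulr1 /k ler_expR ler_pM2r ?invr_gt0// addrC -lerBlDr opprK.
  by rewrite -ler_pdivrMr// ltW.
rewrite ge0_integral_sum//; last 2 first.
- by move=> i; exact: measurable_scaled_indic.
- by move=> i z _; rewrite lee_fin mulr_ge0.
apply: (@le_trans _ _ (\sum_(i < N) (expR ((s + 2 * d) / t a))%:E)).
  apply: lee_sum => i _; rewrite integral_scaled_indic//.
  rewrite (_ : (s + 2 * d) / t a =
    (- M + i.+1%:R * d) / t a + (d - (- M + i%:R * d - s)) / t a)%R.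
    by rewrite expRD EFinM lee_wpmul2l// lee_fin.
  by rewrite -mulrDl -natr1; congr (_ / _)%R; ring.
rewrite sumEFin lee_fin sumr_const card_ord.
rewrite (_ : (expR _ *+ N)%R = expR (ln N%:R + (s + 2 * d) / t a)); last first.
  by rewrite expRD lnK ?posrE ?ltr0n// [RHS]mulr_natl.
rewrite ler_expR.
rewrite (_ : s + e = s + 2 * d + d)%R; last by rewrite /d; lra.
by rewrite [in leRHS]mulrDl addrC lerD2l ler_pdivlMr// mulrC.
Unshelve. all: by end_near. Qed.

(** The supremum of [h - l] is never computed: if the lower limit were below the upper one,
    [varadhan_lower] would make the logarithm of their midpoint an admissible [s], and
    [varadhan_upper] would give a contradiction. *)
Lemma varadhan_limit (h : X -> R) (M : R) : continuous h ->
  (forall x, `|h x| <= M)%R ->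
  exists L : R, [/\ exp_integral_pow mu t h @ F --> L%:E,
     forall x, expeR ((h x)%:E - l x) <= L%:E, (0 <= L)%R &
     forall s, (forall x, (h x - s)%:E <= l x) -> (L <= expR s)%R].
Proof.
move=> ch hM; pose u := exp_integral_pow mu t h.
have upper s := @varadhan_upper h M s ch hM.
have sup_ge0 : 0 <= net_limsup le u.
  by apply: net_limsup_ge => // a; exact: poweR_ge0.
have inf_ge0 : 0 <= net_liminf le u.
  by apply: net_liminf_ge; apply: nearW => a; exact: poweR_ge0.
have supM : net_limsup le u <= (expR M)%:E.
  apply: upper => x; apply: le_trans (ldp_ge0 l_ldp x).
  by rewrite lee_fin subr_le0 (le_trans (ler_norm _)).
rewrite -/u in upper; case supE : (net_limsup le u) sup_ge0 supM upper => [L||]// L0 _ upper.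
have supinf : L%:E <= net_liminf le u.
  rewrite leNgt; apply/negP; have lower x := @varadhan_lower h x ch.
  rewrite -/u in lower; move: inf_ge0 lower.
  case: (net_liminf le u) => [b||]// b0 lower; rewrite lte_fin => bL.
  rewrite lee_fin in b0.
  (* The midpoint is positive even when [b] is 0, so its logarithm is meaningful. *)
  have c0 : (0 < (b + L) / 2)%R by lra.
  suff : L%:E <= (expR (ln ((b + L) / 2)))%:E by rewrite lnK ?posrE// lee_fin; lra.
  apply: upper => x.
  have : expeR ((h x)%:E - l x) <= expeR (ln ((b + L) / 2))%:E.
    by rewrite (le_trans (lower x))//= lnK ?posrE// lee_fin; lra.
  rewrite lee_expeR; have := ldp_ge0 l_ldp x.
  by case: (l x) => [r||]// _; rewrite ?leey// -EFinB !lee_fin; lra.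
exists L; split.
- by apply: net_cvg => //; rewrite supE.
- move=> x; rewrite -supE (le_trans (varadhan_lower x ch))//.
  exact: net_liminf_le_limsup.
- by rewrite lee_fin in L0.
- by move=> s /upper; rewrite lee_fin.
Qed.

(** Together the last two clauses identify [Lambda] with the supremum of [h - l]: an upper bound
    that lies below every real upper bound. *)
Lemma Lambda_ldp (h : X -> R) (M : R) : continuous h ->
  (forall x, `|h x| <= M)%R ->
  [/\ has_Lambda le mu t h, forall x, (h x)%:E - l x <= Lambda le mu t h &
    forall s, (forall x, (h x - s)%:E <= l x) -> Lambda le mu t h <= s%:E].
Proof.
move=> ch hM; have [L [uL lower L0 upper]] := varadhan_limit ch hM.
have LE : expeR (Lambda le mu t h) = L%:E.
  by rewrite /Lambda (cvg_lim _ uL)//; apply/eqP; rewrite lneK_eq lee_fin.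
split.
- by apply/cvg_ex; exists L%:E.
- by move=> x; rewrite -lee_expeR LE.
- by move=> s /upper Ls; rewrite -lee_expeR LE lee_fin.
Qed.

End varadhan.

(** * The rate function as a supremum over the algebra *)

Theorem corollary4 (R : realType) (X : ptopologicalType)
    (X_not_point : exists x y : X, x <> y)
    (X_lc : locally_compact [set: X]) (X_hausdorff : hausdorff_space X)
    (I : Type) (le : I -> I -> Prop) (le_directed : directed le)
    (mu : I -> probability (borel X) R) (t : I -> R)
    (t_gt0 : forall a, (0 < t a)%R)
    (t_cvg0 : t @ net_filter le --> (0 : R)%R)
    (J : X -> \bar R) (J_rate : is_rate_function le mu t J)
    (A : set (X -> R)) (A_algebra : function_algebra A)
    (A_continuous : forall h, A h -> continuous h)
    (A_vanishes : forall h, A h -> vanishes_at_infinity h)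
    (A_separates : separates_points A)
    (A_nonzero : vanishes_nowhere_identically A) :
  (forall h, A h -> has_Lambda le mu t h) /\
  (forall x : X,
     J x = ereal_sup [set (h x)%:E - Lambda le mu t h | h in A]).
Proof.
have [l l_ldp [J_lsc J_le J_max]] := J_rate.
have L h : A h -> [/\ has_Lambda le mu t h,
    forall x, (h x)%:E - l x <= Lambda le mu t h &
    forall s, (forall x, (h x - s)%:E <= l x) -> Lambda le mu t h <= s%:E].
  move=> Ah; have [M hM] :=
    vanishes_at_infinity_bounded (A_continuous _ Ah) (A_vanishes _ Ah).
  exact: (Lambda_ldp le_directed t_gt0 t_cvg0 l_ldp (A_continuous _ Ah) hM).
split=> [h /L[]//|x]; apply/eqP; rewrite eq_le; apply/andP; split; last first.
  apply: ge_ereal_sup => _ [h Ah <-].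
  apply: (J_max (fun y => (h y)%:E - Lambda le mu t h)) => [y b bh|y]; last first.
    have [_ /(_ y) + _] := L h Ah; have := ldp_ge0 l_ldp y.
    case: (l y) => [r||]// _; rewrite ?leey//; 
    case: (Lambda le mu t h) => [s||]//; last by rewrite addeNy leNye.
    by rewrite -!EFinB !lee_fin; lra.
  (* If [Lambda] is real, an open superlevel set of [h] serves as neighborhood; if it is [-oo], the
     function is constantly [+oo]; the value [+oo] contradicts [bh]. *)
  move: bh; case: (Lambda le mu t h) => [s||]//= bh.
  - exists [set z | b + s < h z]%R => [|z /=]; last by rewrite lte_fin ltrBrDr.
    apply: (cvgr_gt _ (A_continuous _ Ah y)).
    by move: bh; rewrite lte_fin ltrBrDr.
  - by exists setT => //; exact: filterT.
set S := ereal_sup _.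
have S_ge h : A h -> (h x)%:E - Lambda le mu t h <= S.
  by move=> Ah; apply: ereal_sup_ubound; exists h.
(* The zero function has [Lambda] at most 0 because [l] is nonnegative; this later makes [a]
   positive. *)
have S0 : 0 <= S.
  apply: le_trans (S_ge _ (algebra0 A_algebra)).
  rewrite sub0e oppe_ge0; have [_ _] := L _ (algebra0 A_algebra); apply => y.
  by rewrite subr0; exact: (ldp_ge0 l_ldp).
rewrite leNgt; apply/negP => SJ.
have [a Sa aJ] : exists2 a : R, S < a%:E & a%:E < J x.
  move: S0 SJ; case: S {S_ge} => [s||]// _; case: (J x) => [r||]// sr.
  - by exists ((s + r) / 2)%R; move: sr; rewrite !lte_fin => sr; lra.
  - by exists (s + 1)%R; rewrite ?ltry// lte_fin ltrDl.
have a0 : (0 < a)%R by rewrite -lte_fin (le_lt_trans S0).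
have [V Vx JV] := J_lsc x a aJ.
suff : a%:E <= S by rewrite leNgt Sa.
apply/lee_subgt0Pr => e e0.
(* After scaling by [a], the height [e / a] allowed off [V] becomes [e]. *)
have [g Ag [gx g1 gV]] := algebra_peak A_algebra A_continuous A_vanishes
  A_separates A_nonzero Vx (divr_gt0 e0 a0).
have Ah : A (fun y => a * g y)%R by exact: (algebraZ A_algebra).
apply: le_trans (S_ge _ Ah); rewrite gx mulr1 leeB//.
(* [Lambda] is at most [e] as soon as [a * g - e <= l]: on [V], [a * g <= a < J <= l]; off [V],
   [a * g <= e] and [0 <= l]. *)
have [_ _] := L _ Ah; apply => y.
have [Vy|nVy] := pselect (V y).
  apply: (@le_trans _ _ a%:E); last exact: le_trans (ltW (JV y Vy)) (J_le y).
  rewrite lee_fin lerBlDr (le_trans (_ : _ <= a)%R)//; last by rewrite lerDl ltW.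
  by rewrite ler_piMr// ltW.
apply: le_trans (ldp_ge0 l_ldp y); rewrite lee_fin subr_le0.
by rewrite mulrC -ler_pdivlMr// gV.
Qed.
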